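(* For all positive integers $n$ and $k$, the number of valleyless sequences of positive integers of length $n$ whose maximum entry is $k$ equals $$V_{n,k}=\binom{n-1+2(k-1)}{2(k-1)}.$$
   Context: A finite sequence $s=s_1,s_2,\ldots,s_n$ of positive integers is called valleyless if for all $1\le i<j<k\le n$ one has $s_j\ge\min\{s_i,s_k\}$. $V_{n,k}$ denotes the number of valleyless sequences of positive integers of length $n$ with maximum entry $k$. *)

(* Defs.v *)
From mathcomp Require Import all_boot finmap.
From mathcomp Require Import mathcomp_extra boolp classical_sets functions.
From mathcomp Require Import cardinality.

Set Implicit Arguments.
Unset Strict Implicit.
Unset Printing Implicit Defensive.

Local Open Scope classical_set_scope.

Definition valleyless (n : nat) (s : n.-tuple nat) : Prop :=
  forall i j k : 'I_n, i < j -> j < k ->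
    minn (tnth s i) (tnth s k) <= tnth s j.

Definition valleyless_seqs (n k : nat) : set (n.-tuple nat) :=
  [set s | [/\ forall i, 0 < tnth s i, valleyless s
             & \max_(i < n) tnth s i = k]].

Arguments valleyless_seqs : clear implicits.

(* [fset_set] is meaningful only on finite sets, whence this lemma. *)
Lemma finite_valleyless_seqs (n k : nat) : finite_set (valleyless_seqs n k).
Proof.
pose f (t : n.-tuple 'I_k.+1) : n.-tuple nat := [tuple val (tnth t i) | i < n].
apply: (@sub_finite_set _ _ (f @` [set: n.-tuple 'I_k.+1])); last first.
  exact/finite_image/finite_finset.
move=> s [_ _ max_s]; exists [tuple inord (tnth s i) | i < n] => //.
apply: eq_from_tnth => i; rewrite !tnth_mktuple /= inordK // ltnS -max_s.
exact: (leq_bigmax i).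
Qed.

Definition V (n k : nat) : nat := #|` fset_set (valleyless_seqs n k)|%fset.

(* Main.v *)
Require Import Defs.
From mathcomp Require Import all_boot.
From mathcomp Require Import finmap classical_sets cardinality zify.

(** A valleyless sequence weakly increases and then weakly decreases, so the
    ones of a valleyless sequence with maximum at least 2 form a prefix and a
    suffix.  Stripping the prefix, then the suffix, and then lowering every
    entry by one leaves a valleyless sequence whose maximum is smaller by one.
    Putting ones back at one end turns the counts [m] choose [r] into their
    partial sums, i.e. raises [r] by one (hockey-stick identity); hence [2] is
    added to the lower index for each unit of the maximum. *)

Set Implicit Arguments.
Unset Strict Implicit.
Unset Printing Implicit Defensive.

Section Padding.

Variables (T : eqType) (f : T -> T) (L : nat -> seq T).

(* [pad n] lists the [f^i t] with [t] in [L (n - i)] and [i < n]; the value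
   [L 0] is never used. *)
Fixpoint pad (n : nat) : seq T :=
  if n is m.+1 then [seq f t | t <- pad m] ++ L n else [::].

Lemma mem_pad (P Q : nat -> T -> Prop) :
    (forall n s, s \in L n.+1 <-> P n.+1 s) ->
    (forall s, ~ Q 0 s) ->
    (forall n s, Q n.+1 s <-> (exists2 t, Q n t & s = f t) \/ P n.+1 s) ->
  forall n s, s \in pad n <-> Q n s.
Proof.
move=> LP Q0 QS; elim=> [|n IHn] s; first by split=> // /Q0.
rewrite QS -LP /= mem_cat; split=> [/orP[/mapP[t /IHn Qt ->]|->]|].
- by left; exists t.
- by right.
- by case=> [[t /IHn tn ->]|->]; rewrite ?orbT // map_f.
Qed.

(** Since [f] never lands in [L n.+1], the two pieces joined at each stage of [pad] are disjoint. *)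
Lemma pad_uniq : injective f -> (forall n, uniq (L n.+1)) ->
  (forall n t, f t \notin L n.+1) -> forall n, uniq (pad n).
Proof.
move=> f_inj uL fL; elim=> //= n IHn.
rewrite cat_uniq map_inj_uniq // IHn uL andbT /=.
apply/hasPn=> s sL; apply/mapP=> -[t _ def_s].
by rewrite def_s (negPf (fL _ _)) in sL.
Qed.

(** Each stage of [pad] adds [size (L n.+1)] to the size so far, which matches Pascal's rule. *)
Lemma size_pad (m : nat) : (forall n, size (L n.+1) = 'C(n + m, m)) ->
  forall n, size (pad n.+1) = 'C(n + m.+1, m.+1).
Proof.
move=> sL; elim=> [|n IHn]; first by rewrite /= sL !add0n !binn.
rewrite -[pad _]/([seq f t | t <- pad n.+1] ++ L n.+2) size_cat size_map IHn sL.
by rewrite [in RHS]addSn binS addSnnS.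
Qed.

End Padding.

(** Plain lists replace tuples because stripping and padding change the length. *)
Definition valleyless_seq (s : seq nat) : Prop :=
  forall i j k, i < j -> j < k -> k < size s ->
    minn (nth 0 s i) (nth 0 s k) <= nth 0 s j.

Definition valleyless_max (k n : nat) (s : seq nat) : Prop :=
  [/\ size s = n, all (leq 1) s, valleyless_seq s & \max_(x <- s) x = k].

(** An end entry is never the middle of a triple, and a 1 as an outer entry makes the minimum at
    most 1, which every positive entry reaches. *)
Lemma valleyless_cons1 (s : seq nat) : all (leq 1) s ->
  valleyless_seq (1 :: s) <-> valleyless_seq s.
Proof.
move=> /(all_nthP 0) s1; split=> vs.
  by move=> i j k ij jk ks; apply: (vs i.+1 j.+1 k.+1).
case=> [|i] [|j] [|k] //= ij jk ks; last exact: vs.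
by rewrite geq_min s1 //; lia.
Qed.

Lemma valleyless_rcons1 (s : seq nat) : all (leq 1) s ->
  valleyless_seq (rcons s 1) <-> valleyless_seq s.
Proof.
move=> /(all_nthP 0) s1; split=> vs i j k ij jk.
  move=> ks; have := vs i j k ij jk; rewrite size_rcons !nth_rcons ks.
  by rewrite (ltn_trans jk ks) (ltn_trans ij (ltn_trans jk ks)); apply; lia.
rewrite size_rcons ltnS leq_eqVlt => ks.
have js : j < size s by lia.
rewrite !nth_rcons js (ltn_trans ij js).
case/predU1P: ks => [->|ks]; last by rewrite ks; apply: vs.
by rewrite ltnn eqxx geq_min (s1 j js) orbT.
Qed.

Lemma valleyless_mapS (s : seq nat) :
  valleyless_seq (map S s) <-> valleyless_seq s.
Proof.
split=> vs i j k ij jk; rewrite ?size_map => ks.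
  have := vs i j k ij jk; rewrite size_map => /(_ ks).
  by rewrite !(nth_map 0) ?minnSS //; lia.
by rewrite !(nth_map 0) ?minnSS ?ltnS; [apply: vs|lia..].
Qed.

(** An inner entry is bounded below by the smaller of the two end entries. *)
Lemma valleyless_all (m : nat) (s : seq nat) : valleyless_seq s ->
  m <= head m s -> m <= last m s -> all (leq m) s.
Proof.
case: s => // x s vs mx ml; apply/(all_nthP 0) => -[|j] //= js.
have [jl|jl] := ltnP j.+1 (size s); last first.
  by move: ml; rewrite (last_nth 0) /= (_ : size s = j.+1) //; lia.
(* Here [s] is the tail, so [size s] is the index of the last entry of [x :: s]. *)
apply: leq_trans (vs 0 j.+1 (size s) isT jl (ltnSn _)).
by rewrite leq_min mx /=; move: ml; rewrite (last_nth 0).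
Qed.

Lemma bigmax_mapS (s : seq nat) : s != [::] ->
  \max_(x <- map S s) x = (\max_(x <- s) x).+1.
Proof.
case: s => // x s _; elim: s x => [|y s IHs] x; first by rewrite /= !big_seq1.
by rewrite big_map !(big_cons _ _ x) -(big_map S xpredT id) /= IHs maxnSS.
Qed.

(** A maximum of at least 2 is never attained at the added 1. *)
Lemma valleyless_max_cons1 (k n : nat) (s : seq nat) :
  valleyless_max k.+2 n.+1 (1 :: s) <-> valleyless_max k.+2 n s.
Proof.
rewrite /valleyless_max /= big_cons; split=> -[sn s1 vs ms].
  by split; [lia| |apply/valleyless_cons1|lia].
by split; [lia| |apply/valleyless_cons1|lia].
Qed.

Lemma valleyless_max_rcons1 (k n : nat) (s : seq nat) :
  valleyless_max k.+2 n.+1 (rcons s 1) <-> valleyless_max k.+2 n s.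
Proof.
rewrite /valleyless_max size_rcons all_rcons big_rcons /= maxnC.
split=> -[sn s1 vs ms].
  by split; [lia| |apply/valleyless_rcons1|lia].
by split; [lia| |apply/valleyless_rcons1|lia].
Qed.

Lemma valleyless_max_mapS (k n : nat) (s : seq nat) : all (leq 1) s ->
  valleyless_max k.+2 n (map S s) <-> valleyless_max k.+1 n s.
Proof.
(* The empty list has maximum 0, so both sides fail for it. *)
move=> s1; have [->|sN0] := eqVneq s [::].
  by rewrite /valleyless_max /= !big_nil; split=> -[].
rewrite /valleyless_max size_map all_map bigmax_mapS //.
split=> -[sn _ vs ms]; split; try exact/valleyless_mapS; rewrite ?ms //.
  exact: succn_inj.
exact/allP.
Qed.

(** Index [k] stands for maximum [k.+1]. The inner [pad] restores the suffix of ones, the outer one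
    the prefix. *)
Fixpoint valleyless_enum (k : nat) : nat -> seq (seq nat) :=
  if k is k'.+1 then
    pad (cons 1) (pad (rcons^~ 1)
      (fun n => [seq map S s | s <- valleyless_enum k' n]))
  else fun n => [:: nseq n 1].

Lemma map_S_pred (s : seq nat) : all (leq 2) s ->
  all (leq 1) (map predn s) /\ s = map S (map predn s).
Proof.
elim: s => //= -[|[|x]] s IHs //= /IHs[s1 def_s].
by split; rewrite -?def_s.
Qed.

Lemma valleyless_max0 (k : nat) (s : seq nat) : ~ valleyless_max k.+1 0 s.
Proof. by case=> /size0nil-> _ _; rewrite big_nil. Qed.

Lemma mem_valleyless_enum0 (n : nat) (s : seq nat) :
  s \in [:: nseq n.+1 1] <-> valleyless_max 1 n.+1 s.
Proof.
rewrite inE; split=> [/eqP->|[sn /allP s1 _ ms]].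
  split; rewrite ?size_nseq ?all_nseq //.
    move=> i j k ij jk; rewrite size_nseq => kn.
    by rewrite !nth_nseq !ifT //; lia.
  by elim: n => [|n IHn]; rewrite /= ?big_seq1 // big_cons IHn.
apply/eqP; rewrite -sn; apply/all_pred1P/allP => x xs /=.
by rewrite eqn_leq s1 // andbT -ms (leq_bigmax_seq x xs).
Qed.

(** These are the sequences left once the prefix of ones is stripped. One that also ends above 1 has
    all entries at least 2 and can be lowered; any other ends in a 1 that can be removed. *)
Lemma mem_pad_right (k : nat) (L : nat -> seq (seq nat)) :
    (forall n s, s \in L n.+1 <-> valleyless_max k.+1 n.+1 s) ->
  forall n s, s \in pad (rcons^~ 1) (fun n => [seq map S t | t <- L n]) n <->
    valleyless_max k.+2 n s /\ 1 < head 0 s.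
Proof.
move=> LP; apply: (@mem_pad _ _ _
  (fun n s => exists2 t, valleyless_max k.+1 n t & s = map S t)).
- move=> n s; split=> [/mapP[t /LP tn ->]|[t /LP tn ->]]; first by exists t.
  exact: map_f.
- by move=> s [/valleyless_max0].
move=> n s; split=> [[vs hs]|].
  have [_ _ vls _] := vs.
  (* The default 2 fits [valleyless_all] at [m = 2] and excludes the empty list from the second
     case. *)
  have [ls|ls] := ltnP 1 (last 2 s).
    have s2 : all (leq 2) s by apply: valleyless_all => //; case: (s) hs.
    right; have [t1 def_s] := map_S_pred s2.
    by exists (map predn s) => //; apply/valleyless_max_mapS; rewrite -?def_s.
  left; case/lastP: s => [|t x] in vs hs vls ls *; first by [].
  have x1 : x = 1.
    case: vs => _; rewrite all_rcons => /andP[x1 _] _ _.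
    by move: ls; rewrite last_rcons; lia.
  rewrite {}x1 in vs hs *; exists t => //; split.
    exact/valleyless_max_rcons1.
  by case: (t) hs.
case=> [[t [vt ht] ->]|[t vt ->]]; split.
- exact/valleyless_max_rcons1.
- by case: (t) ht.
- by apply/valleyless_max_mapS => //; case: vt.
- by case: vt; case: t => // x t _ /andP[].
Qed.

Lemma mem_valleyless_enum (k n : nat) (s : seq nat) :
  s \in valleyless_enum k n.+1 <-> valleyless_max k.+1 n.+1 s.
Proof.
elim: k n s => [|k IHk] n s; first exact: mem_valleyless_enum0.
apply: (@mem_pad _ _ _ (fun n s => valleyless_max k.+2 n s /\ 1 < head 0 s)).
- by move=> ? ?; apply: mem_pad_right.
- exact: valleyless_max0.
move=> {}n {}s; split=> [vs|[[t vt ->]|[]//]]; last exact/valleyless_max_cons1.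
have [hs|hs] := ltnP 1 (head 0 s); [by right|left].
case: s => [|x s] in vs hs *; first by case: vs.
have def_x : x = 1 by case: vs => _ /andP[x1 _] _ _; move: hs => /=; lia.
by rewrite {}def_x in vs *; exists s => //; apply/valleyless_max_cons1.
Qed.

Lemma valleyless_enum_uniq (k n : nat) : uniq (valleyless_enum k n).
Proof.
elim: k n => [|k IHk] // n; apply: pad_uniq => [s t []//|{}n|{}n t].
- apply: pad_uniq => [||{}n t]; first exact: rcons_injl.
    by move=> ?; rewrite map_inj_uniq //; apply/inj_map/succn_inj.
  (* A raised list of positive entries cannot end in 1. *)
  apply/mapP => -[u /mem_valleyless_enum[_ /allP u1 _ _]].
  case/lastP: u u1 => [_|u x u1]; first by case: t.
  rewrite map_rcons => /rcons_inj[_ x0].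
  by have := u1 x; rewrite mem_rcons mem_head -x0 => /(_ isT).
(* Lists from the inner [pad] start above 1, so none has the form [1 :: t]. *)
- by apply/negP => /(mem_pad_right (@mem_valleyless_enum k))[].
Qed.

Lemma size_valleyless_enum (k n : nat) :
  size (valleyless_enum k n.+1) = 'C(n + 2 * k, 2 * k).
Proof.
elim: k n => [|k IHk] n; first by rewrite muln0 bin0.
(* Each of the two nested paddings raises the lower index by one. *)
rewrite mulnS; apply: size_pad => {}n; apply: size_pad => {}n.
by rewrite size_map.
Qed.

Lemma valleyless_seqsP (n k : nat) (s : n.-tuple nat) :
  valleyless_seqs n k s <-> valleyless_max k n s.
Proof.
have -> : valleyless_max k n s <->
    [/\ all (leq 1) s, valleyless_seq s & \max_(x <- s) x = k].
  by split=> [[]|[]] *; split=> //; exact: size_tuple.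
rewrite big_tuple /valleyless_seqs /=; split=> -[s1 vs ms]; split=> //.
- by apply/all_tnthP.
- move=> i j l ij jl; rewrite size_tuple => ln.
  have jn := ltn_trans jl ln; have i_n := ltn_trans ij jn.
  have := vs (Ordinal i_n) (Ordinal jn) (Ordinal ln) ij jl.
  by rewrite !(tnth_nth 0).
- by apply/all_tnthP.
- move=> i j l ij jl; rewrite !(tnth_nth 0); apply: vs => //.
  by rewrite size_tuple.
Qed.

Theorem theorem3 (n k : nat) (n_gt0 : 0 < n) (k_gt0 : 0 < k) :
  V n k = 'C(n - 1 + 2 * (k - 1), 2 * (k - 1)).
Proof.
case: n k n_gt0 k_gt0 => [//|n] [//|k] _ _.
(* Forgetting the tuple structure leaves two duplicate-free lists to compare, and they have the same
   members. *)
rewrite !subn1 -size_valleyless_enum /V -(size_map val).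
apply/perm_size/uniq_perm; last 1 first.
- move=> s; apply/mapP/idP => [[t tV ->]|/mem_valleyless_enum vs].
    apply/mem_valleyless_enum/valleyless_seqsP/set_mem.
    by rewrite -in_fset_set //; apply: finite_valleyless_seqs.
  have /eqP sn : size s = n.+1 by case: vs.
  exists (Tuple sn) => //; rewrite in_fset_set; last exact: finite_valleyless_seqs.
  exact/mem_set/valleyless_seqsP.
- by rewrite map_inj_uniq //; apply: val_inj.
- exact: valleyless_enum_uniq.
Qed.
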